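(* Let $m_0,m_1$ be positive integers with $m_0+m_1=n$ and consider the single-species $t$-PushTASEP with content $\langle 1^{m_1},0^{m_0}\rangle$ and parameters $x_1,\dots,x_n>0$, $t\in[0,1)$. The stationary current $J_{m_0,m_1}$ across the edge between sites $n$ and $1$ is \[ J_{m_0,m_1}=\frac{1+2t+3t^2+\dots+m_0t^{m_0-1}}{1+t+\dots+t^{m_0-1}}\cdot\frac{e_{m_1-1}(x_1,\dots,x_n)}{e_{m_1}(x_1,\dots,x_n)} =\frac{\frac{d}{dt}(1+t+\dots+t^{m_0})}{1+t+\dots+t^{m_0-1}}\cdot\frac{e_{m_1-1}(x_1,\dots,x_n)}{e_{m_1}(x_1,\dots,x_n)}. \]
   Context: Sites $1,\dots,n$ lie on a ring with clockwise order $1\to2\to\cdots\to n\to1$. The configurations are $\eta\in\{0,1\}^n$ with exactly $m_1$ ones (particles) and $m_0$ zeros (vacancies). The single-species $t$-PushTASEP is the continuous-time Markov chain in which each site $k$ has an independent exponential clock of rate $1/x_k$; when it rings and $\eta_k=1$, the particle at $k$ moves to the $\ell$-th vacancy encountered going clockwise from $k$ with probability $t^{\ell-1}/(1+t+\dots+t^{m_0-1})$, $1\le\ell\le m_0$ (if $\eta_k=0$ nothing happens). The stationary current across the edge $(n,1)$ is $J_{m_0,m_1}=\sum_\eta\pi(\eta)\sum_{k:\eta_k=1}\frac1{x_k}\,\mathbb{P}(\text{the chosen vacancy }j\text{ satisfies }j<k)$, where $\pi$ is the stationary distribution; i.e. the rate at which particles cross from site $n$ to site $1$ in stationarity. $e_k$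 denotes the elementary symmetric polynomial of degree $k$ ($e_0=1$). *)

(* Defs.v *)
From HB Require Import structures.
From mathcomp Require Import all_boot all_order all_algebra.
From mathcomp Require mpoly.
From mathcomp Require Import all_classical all_reals all_analysis.

Set Implicit Arguments.
Unset Strict Implicit.
Unset Printing Implicit Defensive.

Import Order.TTheory GRing.Theory Num.Theory.
Import numFieldNormedType.Exports.
Local Open Scope ring_scope.

(* Sites 1, ..., n are the elements 0, ..., n - 1 of 'I_n; clockwise is ordS,
   so the edge (n, 1) joins n - 1 to 0. *)

Notation config n m0 m1 :=
  {eta : {ffun 'I_n -> bool} |
    (#|[pred k | eta k]| == m1) && (#|[pred k | ~~ eta k]| == m0)}.

(* The l-th vacancy met clockwise from k has index l - 1 in this sequence. *)
Definition vacancies_from (n : nat) (eta : {ffun 'I_n -> bool}) (k : 'I_n) :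
    seq 'I_n :=
  [seq j <- traject (@ordS n) (ordS k) n.-1 | ~~ eta j].

Definition move (n : nat) (eta : {ffun 'I_n -> bool}) (k j : 'I_n) :
    {ffun 'I_n -> bool} :=
  [ffun i => if i == j then true else if i == k then false else eta i].

(* Probability that the particle at k chooses the vacancy j. When eta has m0
   vacancies and eta k holds, vacancies_from eta k has size m0, so the default
   value of nth is never used. *)
Definition jump_prob (R : realType) (n m0 : nat) (t : R)
    (eta : {ffun 'I_n -> bool}) (k j : 'I_n) : R :=
  \sum_(l < m0 | nth k (vacancies_from eta k) l == j)
    t ^+ l / (\sum_(i < m0) t ^+ i).

Definition rate (R : realType) (n m0 m1 : nat) (x : 'I_n -> R) (t : R)
    (eta zeta : config n m0 m1) : R :=
  \sum_(k < n | val eta k) \sum_(j < n | val zeta == move (val eta) k j)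
    (x k)^-1 * jump_prob m0 t (val eta) k j.

Definition generator (R : realType) (n m0 m1 : nat) (x : 'I_n -> R) (t : R)
    (eta zeta : config n m0 m1) : R :=
  rate x t eta zeta
    - (if eta == zeta then \sum_(xi : config n m0 m1) rate x t eta xi else 0).

Definition stationary (R : realType) (n m0 m1 : nat) (x : 'I_n -> R) (t : R)
    (pi : {ffun config n m0 m1 -> R}) : Prop :=
  [/\ forall eta, 0 <= pi eta,
      \sum_(eta : config n m0 m1) pi eta = 1
    & forall zeta, \sum_(eta : config n m0 m1) pi eta * generator x t eta zeta = 0].

Definition current (R : realType) (n m0 m1 : nat) (x : 'I_n -> R) (t : R)
    (pi : {ffun config n m0 m1 -> R}) : R :=
  \sum_(eta : config n m0 m1) pi eta *
    \sum_(k < n | val eta k) (x k)^-1 *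
      \sum_(j < n | (j < k)%N) jump_prob m0 t (val eta) k j.

Definition elem_sym (R : realType) (n k : nat) (x : 'I_n -> R) : R :=
  mpoly.meval x (mpoly.mesym n R k).

(* Main.v *)
Require Import Defs.
From HB Require Import structures.
From mathcomp Require Import all_boot all_order all_algebra.
From mathcomp Require Import zify ring.
From mathcomp Require Import all_classical all_reals all_analysis.

Set Implicit Arguments.
Unset Strict Implicit.
Unset Printing Implicit Defensive.

Import Order.TTheory GRing.Theory Num.Theory.
Import numFieldNormedType.Exports.
Local Open Scope ring_scope.

(* The stationary distribution is [pi(eta) = (prod of x_k over the particles k)
   / e_{m1}(x)]. A jump of the particle at [k] in [eta] carries weight
   [prod_{A} x] with [A = eta \ {k}]. Number the [m0 + 1] vacancies of [A] in
   the order [s_0 < ... < s_{m0}]; the particle sits at some [s_i] and moves to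
   [s_{i+l mod m0+1}] with probability proportional to [t^(l-1)], [1 <= l <= m0].
   For fixed [l] the shift is a bijection of the vacancies, which gives the
   balance equations, and exactly [l] values of [i] make the jump cross the edge
   [(n, 1)], which gives the current. Uniqueness: if [mu = h pi] is stationary
   then [h] is constant along transitions by a Dirichlet form computation; the
   jumps [l = 1] make [h (A + s_i)] independent of [i], and such exchanges
   connect all configurations. *)

(** * Vacancies in increasing and in clockwise order *)

Definition set_config (n : nat) (B : {set 'I_n}) : {ffun 'I_n -> bool} :=
  [ffun i => i \in B].

Definition empty_sites (n : nat) (A : {set 'I_n}) : seq 'I_n :=
  [seq j <- enum 'I_n | j \notin A].

Lemma iter_ordS (n : nat) (k : 'I_n) (i : nat) :
  iter i (@ordS n) k = ((k + i) %% n)%N :> nat.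
Proof.
elim: i => [|i IH] /=; first by rewrite addn0 modn_small.
by rewrite IH -addn1 modnDml addn1 addnS.
Qed.

(** The trajectory wraps past the edge at index [n - k.+1], which cuts it into two increasing
    runs. *)
Lemma traject_ordS (n : nat) (k : 'I_n) :
  traject (@ordS n) (ordS k) n.-1 =
  drop k.+1 (enum 'I_n) ++ take k (enum 'I_n).
Proof.
have kn := ltn_ord k.
have szd : size (drop k.+1 (enum 'I_n)) = (n - k.+1)%N.
  by rewrite size_drop size_enum_ord.
apply: (@eq_from_nth _ (ordS k)).
  rewrite size_traject size_cat szd size_take size_enum_ord kn; lia.
move=> i; rewrite size_traject => hi.
rewrite nth_traject // -iterSr; apply: val_inj; rewrite [LHS]iter_ordS.
rewrite nth_cat szd; case: ltnP => hlt.
  by rewrite [RHS]/= nth_drop nth_enum_ord; [rewrite modn_small; lia | lia].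
rewrite nth_take; last by lia.
rewrite [RHS]nth_enum_ord; last by lia.
have -> : (k + i.+1 = (i - (n - k.+1)) + n)%N by lia.
by rewrite modnDr modn_small //; lia.
Qed.

Lemma size_empty_sites (n : nat) (A : {set 'I_n}) :
  size (empty_sites A) = (n - #|A|)%N.
Proof.
rewrite /empty_sites enumT.
have -> : [seq j <- Finite.enum 'I_n | j \notin A] = enum (~: A).
  by rewrite /enum_mem; apply: eq_filter => j; rewrite !inE.
by rewrite -cardE [LHS]cardsCs finset.setCK card_ord.
Qed.

Lemma empty_sites_uniq (n : nat) (A : {set 'I_n}) : uniq (empty_sites A).
Proof. by rewrite filter_uniq ?enum_uniq. Qed.

Lemma mem_empty_sites (n : nat) (A : {set 'I_n}) (k : 'I_n) :
  (k \in empty_sites A) = (k \notin A).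
Proof. by rewrite mem_filter mem_enum andbT. Qed.

(** Turns the crossing condition [j < k] between sites into a comparison of vacancy indices. *)
Lemma empty_sites_lt (n : nat) (A : {set 'I_n}) (k0 : 'I_n) (i j : nat) :
  (i < size (empty_sites A))%N -> (j < size (empty_sites A))%N ->
  (nth k0 (empty_sites A) i < nth k0 (empty_sites A) j)%N = (i < j)%N.
Proof.
move=> hi hj.
have srt : sorted (fun a b : 'I_n => (a < b)%N) (empty_sites A).
  apply: sorted_filter; first by move=> a b c; apply: ltn_trans.
  have : sorted ltn (map val (enum 'I_n)) by rewrite val_enum_ord iota_ltn_sorted.
  by rewrite sorted_map.
have tr : transitive (fun a b : 'I_n => (a < b)%N).
  by move=> a b c; apply: ltn_trans.
case: (ltngtP i j) => [ij|ji|->]; last by rewrite ltnn.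
- by apply: (sorted_ltn_nth tr) => //; rewrite inE.
- by apply/negbTE; rewrite -leqNgt ltnW //; apply: (sorted_ltn_nth tr) => //; rewrite inE.
Qed.

Lemma vacancies_fromE (n : nat) (A : {set 'I_n}) (k : 'I_n) :
  k \notin A ->
  vacancies_from (set_config (k |: A)) k =
  drop (index k (empty_sites A)).+1 (empty_sites A)
    ++ take (index k (empty_sites A)) (empty_sites A).
Proof.
move=> kA.
set p := take k (enum 'I_n); set q := drop k.+1 (enum 'I_n).
have epq : enum 'I_n = p ++ k :: q.
  rewrite -[LHS](cat_take_drop k) (drop_nth k) ?size_enum_ord //.
  by rewrite nth_ord_enum.
have := enum_uniq 'I_n; rewrite epq cat_uniq /= => /and3P[_ hp /andP[hq _]].
have kp : k \notin p by apply: contra hp => kp; rewrite kp.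
have esE : empty_sites A = [seq j <- p | j \notin A] ++ k :: [seq j <- q | j \notin A].
  by rewrite /empty_sites epq filter_cat /= kA.
have idx : index k (empty_sites A) = size [seq j <- p | j \notin A].
  by rewrite esE index_cat mem_filter (negbTE kp) andbF /= eqxx addn0.
rewrite idx esE take_size_cat // -cat_rcons drop_size_cat ?size_rcons //.
rewrite /vacancies_from traject_ordS -/p -/q filter_cat.
(* The configurations [k |: A] and [A] differ only at [k], which lies in neither [p] nor [q]. *)
by congr (_ ++ _); apply: eq_in_filter => j jq; rewrite ffunE !inE;
  case: eqP jq => // ->; rewrite ?(negbTE kp) ?(negbTE hq).
Qed.

(* Removing the jumping particle leaves [A], whose vacancies are numbered
   cyclically from the edge; the particle at vacancy [i] that picks its
   [l]-th vacancy then lands at vacancy [i + l + 1]. *)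
Lemma nth_vacancies_from (n m0 : nat) (A : {set 'I_n}) (k0 k1 : 'I_n) (i l : nat) :
  size (empty_sites A) = m0.+1 -> (i < m0.+1)%N -> (l < m0)%N ->
  let s := empty_sites A in
  nth k1 (vacancies_from (set_config (nth k0 s i |: A)) (nth k0 s i)) l =
  nth k0 s ((i + l.+1) %% m0.+1).
Proof.
move=> sz hi hl s.
have kA : nth k0 s i \notin A by rewrite -mem_empty_sites mem_nth ?sz.
rewrite vacancies_fromE // -/s index_uniq ?empty_sites_uniq ?sz //.
rewrite nth_cat size_drop sz; case: ltnP => hlt.
  rewrite nth_drop modn_small; last by lia.
  by rewrite addnS addSn; apply: set_nth_default; rewrite sz; lia.
rewrite nth_take; last by lia.
have -> : (i + l.+1 = (l - (m0.+1 - i.+1)) + m0.+1)%N by lia.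
rewrite modnDr modn_small; last by lia.
by apply: set_nth_default; rewrite sz; lia.
Qed.

Lemma move_set_config (n : nat) (A : {set 'I_n}) (k j : 'I_n) :
  k \notin A -> move (set_config (k |: A)) k j = set_config (j |: A).
Proof.
move=> kA; apply/ffunP => i; rewrite !ffunE !inE; case: eqP => //= _.
by case: eqP => // ->; rewrite (negbTE kA).
Qed.

(** * Reindexing of sums over sets, vacancies and configurations *)

(** Double counting: a set with a marked element is the same as a smaller set with a marked outside
    point. *)
Lemma sum_remove_elt (T : finType) (V : nmodType) (m : nat)
    (F : {set T} -> T -> V) :
  \sum_(B : {set T} | #|B| == m.+1) \sum_(k in B) F (B :\ k) k =
  \sum_(A : {set T} | #|A| == m) \sum_(k | k \notin A) F A k.
Proof.
rewrite !pair_big_dep /=.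
rewrite (reindex_onto (fun p => (p.2 |: p.1, p.2)) (fun p => (p.1 :\ p.2, p.2))) /=; last first.
  by move=> [B k] /= /andP[_ kB]; rewrite finset.setD1K.
apply: eq_big => [[A k]|[A k]] /=.
  rewrite setU11 andbT cardsU1; case: (boolP (k \in A)) => kA /=.
    (* If [k] is already in [A], then [(k |: A) :\ k] loses [k] and cannot equal [A]. *)
    rewrite andbF; apply/andP => -[_ /eqP[e]].
    by have := kA; rewrite -e !inE eqxx.
  by rewrite setU1K // eqxx !andbT.
case/andP=> _ /eqP[->] //.
Qed.

Lemma sum_empty_sites (n : nat) (V : nmodType) (A : {set 'I_n}) (k0 : 'I_n)
    (F : 'I_n -> V) (m : nat) : size (empty_sites A) = m ->
  \sum_(k | k \notin A) F k = \sum_(i < m) F (nth k0 (empty_sites A) i).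
Proof.
move=> <-; rewrite -(big_mkord xpredT (fun i => F (nth k0 (empty_sites A) i))).
by rewrite -(big_nth k0 xpredT F) big_filter big_enum_cond.
Qed.

Lemma sum_mod_shift (V : nmodType) (m a : nat) (F : nat -> V) :
  \sum_(i < m) F ((i + a) %% m)%N = \sum_(i < m) F i.
Proof.
case: m => [|m]; first by rewrite !big_ord0.
pose f (i : 'I_m.+1) : 'I_m.+1 := inord ((i + a) %% m.+1).
have fE i : f i = ((i + a) %% m.+1)%N :> nat by rewrite inordK ?ltn_pmod.
have inj : injective f.
  move=> i j /(congr1 val) /=; rewrite !fE => /eqP.
  rewrite eqn_modDr !modn_small // => /eqP; exact: val_inj.
rewrite [RHS](reindex_inj inj); apply: eq_bigr => i _; by rewrite fE.
Qed.

(** The two counts add up to [n], so the number of particles decides both. *)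
Lemma set_configP (n m0 m1 : nat) (B : {set 'I_n}) : (m0 + m1)%N = n ->
  (#|[pred k | set_config B k]| == m1) && (#|[pred k | ~~ set_config B k]| == m0)
  = (#|B| == m1).
Proof.
move=> e.
have -> : #|[pred k | set_config B k]| = #|B|.
  by apply: eq_card => k; rewrite !inE ffunE.
have -> : #|[pred k | ~~ set_config B k]| = #|~: B|.
  by apply: eq_card => k; rewrite !inE ffunE.
have := cardsC B; rewrite card_ord; lia.
Qed.

Lemma set_configK (n : nat) (f : {ffun 'I_n -> bool}) :
  set_config [set k | f k] = f.
Proof. by apply/ffunP => k; rewrite ffunE inE. Qed.

(** Sums move to sets, where adding and removing a particle is easy; [insub] is the partial inverse
    of the reindexing. *)
Lemma sum_config (V : nmodType) (n m0 m1 : nat) (F : {ffun 'I_n -> bool} -> V) :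
  (m0 + m1)%N = n ->
  \sum_(eta : config n m0 m1) F (val eta) =
  \sum_(B : {set 'I_n} | #|B| == m1) F (set_config B).
Proof.
move=> e.
rewrite [RHS](reindex_omap
  (fun eta : config n m0 m1 => [set k | val eta k]%SET)
  (fun B => insub (set_config B))) /=.
  apply: eq_big => [eta|eta _]; rewrite set_configK //.
  by rewrite valK eqxx andbT -(set_configP _ e) set_configK; case: eta.
move=> B hB; rewrite insubT ?set_configP // => p /=; congr Some.
by apply/setP => k; rewrite inE ffunE.
Qed.

(** * Jump probabilities and rates *)

Lemma geom_gt0 (R : realType) (m : nat) (t : R) :
  (0 < m)%N -> 0 <= t -> 0 < \sum_(i < m) t ^+ i.
Proof.
case: m => // m _ t_ge0; rewrite big_ord_recl expr0 ltr_pwDl //.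
by apply: sumr_ge0 => i _; rewrite exprn_ge0.
Qed.

(** Each [l] selects exactly one site [j], so an average over targets becomes a sum over [l]. *)
Lemma sum_jump_prob (R : realType) (n m0 : nat) (t : R)
    (eta : {ffun 'I_n -> bool}) (k : 'I_n) (G : 'I_n -> R) :
  \sum_j jump_prob m0 t eta k j * G j =
  \sum_(l < m0) t ^+ l / (\sum_(i < m0) t ^+ i)
    * G (nth k (vacancies_from eta k) l).
Proof.
rewrite /jump_prob; under eq_bigr => j _ do rewrite big_distrl.
rewrite (exchange_big_dep xpredT) //=; apply: eq_bigr => l _.
rewrite (big_pred1 (nth k (vacancies_from eta k) l)) // => j.
Qed.

Lemma jump_prob_ge0 (R : realType) (n m0 : nat) (t : R)
    (eta : {ffun 'I_n -> bool}) (k j : 'I_n) :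
  0 <= t -> 0 <= jump_prob m0 t eta k j.
Proof.
move=> t_ge0; apply: sumr_ge0 => l _; rewrite divr_ge0 ?exprn_ge0 //.
by apply: sumr_ge0 => i _; rewrite exprn_ge0.
Qed.

Lemma rate_ge0 (R : realType) (n m0 m1 : nat) (x : 'I_n -> R) (t : R)
    (eta zeta : config n m0 m1) :
  (forall k, 0 < x k) -> 0 <= t -> 0 <= rate x t eta zeta.
Proof.
move=> x_gt0 t_ge0; apply: sumr_ge0 => k _; apply: sumr_ge0 => j _.
by rewrite mulr_ge0 ?jump_prob_ge0 // invr_ge0 ltW.
Qed.

(** Used in [exit_rate]: the moved configuration keeps [m1] particles and stays in the state
    space. *)
Lemma vacancies_from_notin (n m0 m1 : nat) (B : {set 'I_n}) (k : 'I_n) (l : nat) :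
  (m0 + m1)%N = n -> #|B| == m1 -> k \in B -> (l < m0)%N ->
  nth k (vacancies_from (set_config B) k) l \notin B :\ k.
Proof.
move=> e hB kB hl.
have kA : k \notin B :\ k by rewrite !inE eqxx.
have sz : size (empty_sites (B :\ k)) = m0.+1.
  rewrite size_empty_sites; move: e; rewrite -(eqP hB) (cardsD1 k B) kB => e.
  by rewrite -[X in (X - _)%N]e addnA addnK addn1.
have hi : (index k (empty_sites (B :\ k)) < m0.+1)%N.
  by rewrite -sz index_mem mem_empty_sites.
have ki : nth k (empty_sites (B :\ k)) (index k (empty_sites (B :\ k))) = k.
  by rewrite nth_index ?mem_empty_sites.
have := nth_vacancies_from k k sz hi hl; rewrite /= ki finset.setD1K // => ->.
by rewrite -mem_empty_sites mem_nth // sz ltn_pmod.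
Qed.

Lemma exists_config (n m0 m1 : nat) (B : {set 'I_n}) :
  (m0 + m1)%N = n -> #|B| == m1 ->
  exists eta : config n m0 m1, val eta = set_config B.
Proof.
by move=> e hB; rewrite -(set_configP _ e) in hB; exists (Sub (set_config B) hB).
Qed.

Lemma config_set (n m0 m1 : nat) (eta : config n m0 m1) :
  exists2 B : {set 'I_n}, #|B| == m1 & val eta = set_config B.
Proof.
exists [set k | val eta k]%SET; last by rewrite set_configK.
rewrite cardsE; by case: eta => /= f /andP[].
Qed.

(** * The product weight and weighted sums over jumps *)

Definition weight (R : realType) (n : nat) (x : 'I_n -> R)
    (eta : {ffun 'I_n -> bool}) : R := \prod_(k | eta k) x k.

Lemma weight_gt0 (R : realType) (n : nat) (x : 'I_n -> R)
    (eta : {ffun 'I_n -> bool}) : (forall k, 0 < x k) -> 0 < weight x eta.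
Proof. by move=> x_gt0; apply: prodr_gt0. Qed.

Lemma weight_set_config (R : realType) (n : nat) (x : 'I_n -> R)
    (B : {set 'I_n}) : weight x (set_config B) = \prod_(k in B) x k.
Proof. by apply: eq_bigl => k; rewrite ffunE. Qed.

Lemma elem_symE (R : realType) (n m : nat) (x : 'I_n -> R) :
  elem_sym m x = \sum_(B : {set 'I_n} | #|B| == m) \prod_(k in B) x k.
Proof.
rewrite /elem_sym /mpoly.mesym (big_morph _ (mpoly.mevalD x) (mpoly.meval0 x)).
apply: eq_bigr => B _; rewrite (big_morph _ (mpoly.mevalM x) (mpoly.meval1 x)).
by apply: eq_bigr => k _; exact: mpoly.mevalXU.
Qed.

Lemma sum_weight (R : realType) (n m0 m1 : nat) (x : 'I_n -> R) :
  (m0 + m1)%N = n ->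
  \sum_(eta : config n m0 m1) weight x (val eta) = elem_sym m1 x.
Proof.
move=> e; rewrite sum_config // elem_symE.
by apply: eq_bigr => B _; rewrite weight_set_config.
Qed.

(** The rate [(x k)^-1] cancels the factor [x k] of the weight, leaving the product over [A], the
    configuration without [k]; [sum_remove_elt] then regroups by [A]. *)
Lemma sum_weight_particles (R : realType) (n m0 m1 : nat) (x : 'I_n -> R)
    (k0 : 'I_n) (F : 'I_n -> {ffun 'I_n -> bool} -> R) :
  (0 < m1)%N -> (m0 + m1)%N = n -> (forall k, 0 < x k) ->
  \sum_(eta : config n m0 m1)
    weight x (val eta) * \sum_(k | val eta k) (x k)^-1 * F k (val eta) =
  \sum_(A : {set 'I_n} | #|A| == m1.-1) (\prod_(k in A) x k) *
    \sum_(i < m0.+1) F (nth k0 (empty_sites A) i)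
                       (set_config (nth k0 (empty_sites A) i |: A)).
Proof.
move=> m1_gt0 e x_gt0.
rewrite (sum_config (fun eta => weight x eta *
   \sum_(k | eta k) (x k)^-1 * F k eta) e).
pose H (A : {set 'I_n}) k := (\prod_(i in A) x i) * F k (set_config (k |: A)).
transitivity (\sum_(B : {set 'I_n} | #|B| == m1.-1.+1) \sum_(k in B) H (B :\ k) k).
  rewrite prednK //; apply: eq_bigr => B _.
  rewrite mulr_sumr; apply: eq_big => k; rewrite ffunE // => kB.
  rewrite /H weight_set_config (big_setD1 k) //= finset.setD1K // mulrA.
  by congr (_ * _); rewrite mulrAC divff ?mul1r // gt_eqF.
rewrite sum_remove_elt; apply: eq_bigr => A /eqP hA; rewrite /H mulr_sumr.
by apply: sum_empty_sites; rewrite size_empty_sites hA; lia.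
Qed.

(** Serves twice: with [G] the indicator of the resulting configuration it gives balance, with [G]
    the indicator of crossing the edge it gives the current. *)
Lemma sum_weight_jumps (R : realType) (n m0 m1 : nat) (x : 'I_n -> R) (t : R)
    (k0 : 'I_n) (G : 'I_n -> 'I_n -> {ffun 'I_n -> bool} -> R) :
  (0 < m1)%N -> (m0 + m1)%N = n -> (forall k, 0 < x k) ->
  \sum_(eta : config n m0 m1) weight x (val eta) *
    \sum_(k | val eta k) (x k)^-1 *
      \sum_j jump_prob m0 t (val eta) k j * G k j (move (val eta) k j) =
  \sum_(A : {set 'I_n} | #|A| == m1.-1) (\prod_(k in A) x k) *
    \sum_(l < m0) t ^+ l / (\sum_(i < m0) t ^+ i) *
      \sum_(i < m0.+1)
        let k := nth k0 (empty_sites A) i in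
        let j := nth k0 (empty_sites A) ((i + l.+1) %% m0.+1) in
        G k j (set_config (j |: A)).
Proof.
move=> m1_gt0 e x_gt0.
rewrite (sum_weight_particles k0 (fun k eta =>
   \sum_j jump_prob m0 t eta k j * G k j (move eta k j)) m1_gt0 e x_gt0).
apply: eq_bigr => A /eqP hA; congr (_ * _).
have sz : size (empty_sites A) = m0.+1 by rewrite size_empty_sites hA; lia.
under eq_bigr => i _ do rewrite sum_jump_prob.
rewrite exchange_big /=; apply: eq_bigr => l _; rewrite mulr_sumr.
apply: eq_bigr => i _; rewrite (nth_vacancies_from _ _ sz) // move_set_config //.
by rewrite -mem_empty_sites mem_nth ?sz.
Qed.

(** * Balance equations for the product weight *)

Lemma rateE (R : realType) (n m0 m1 : nat) (x : 'I_n -> R) (t : R)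
    (eta zeta : config n m0 m1) :
  rate x t eta zeta = \sum_(k | val eta k) (x k)^-1 *
    \sum_j jump_prob m0 t (val eta) k j * (val zeta == move (val eta) k j)%:R.
Proof.
apply: eq_bigr => k _; rewrite mulr_sumr big_mkcond; apply: eq_bigr => j _.
by case: eqP => _; rewrite ?mulr1 ?mulr0.
Qed.

(** Every jump leads to exactly one configuration, and the jump probabilities of a particle sum to
    1. *)
Lemma exit_rate (R : realType) (n m0 m1 : nat) (x : 'I_n -> R) (t : R)
    (eta : config n m0 m1) :
  (0 < m0)%N -> (m0 + m1)%N = n -> 0 <= t ->
  \sum_(zeta : config n m0 m1) rate x t eta zeta =
  \sum_(k | val eta k) (x k)^-1.
Proof.
move=> m0_gt0 e t_ge0; under eq_bigr => zeta _ do rewrite rateE.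
rewrite exchange_big /=; apply: eq_bigr => k etak.
rewrite -mulr_sumr exchange_big /=.
under eq_bigr => j _ do rewrite -mulr_sumr.
rewrite sum_jump_prob -[RHS]mulr1; congr (_ * _).
rewrite -[RHS](divff (lt0r_neq0 (geom_gt0 m0_gt0 t_ge0))) big_distrl.
apply: eq_bigr => l _ /=; rewrite -[RHS]mulr1; congr (_ * _).
have [B hB etaE] := config_set eta.
have kB : k \in B by move: etak; rewrite etaE ffunE.
have jA := vacancies_from_notin e hB kB (ltn_ord l).
rewrite -etaE in jA; set j := nth k _ l in jA *.
have -> : move (val eta) k j = set_config (j |: B :\ k).
  by rewrite etaE -{1}(finset.setD1K kB) move_set_config // !inE eqxx.
have hP : #|j |: B :\ k| == m1.
  by rewrite cardsU1 jA -(eqP hB) [X in _ == X](cardsD1 k B) kB.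
have [zeta <-] := exists_config e hP.
rewrite (bigD1 zeta) //= eqxx big1 ?addr0 // => xi.
by rewrite -val_eqE /= => /negbTE ->.
Qed.

(* Each cyclic shift of the vacancies of [A] is a bijection, so every
   [A] with a particle added is entered with total probability 1. *)
Lemma weight_balance (R : realType) (n m0 m1 : nat) (x : 'I_n -> R) (t : R)
    (zeta : config n m0 m1) :
  (0 < m0)%N -> (0 < m1)%N -> (m0 + m1)%N = n -> (forall k, 0 < x k) ->
  0 <= t ->
  \sum_(eta : config n m0 m1) weight x (val eta) * rate x t eta zeta =
  weight x (val zeta) * \sum_(xi : config n m0 m1) rate x t zeta xi.
Proof.
move=> m0_gt0 m1_gt0 e x_gt0 t_ge0.
have k0 : 'I_n by apply: (@Ordinal _ 0); lia.
under eq_bigr => eta _ do rewrite rateE.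
rewrite (sum_weight_jumps t k0 (fun _ _ f => (val zeta == f)%:R)) //.
transitivity (\sum_(A : {set 'I_n} | #|A| == m1.-1) (\prod_(k in A) x k) *
    \sum_(i < m0.+1) (val zeta == set_config (nth k0 (empty_sites A) i |: A))%:R : R).
  apply: eq_bigr => A _; congr (_ * _).
  under eq_bigr => l _ do rewrite (sum_mod_shift _ l.+1 (fun j =>
    (val zeta == set_config (nth k0 (empty_sites A) j |: A))%:R)).
  by rewrite -!mulr_suml divff ?mul1r // gt_eqF // geom_gt0.
(* The inflow no longer involves [l]; read backwards, it sums over the particles of [zeta] itself,
   which is the outflow. *)
rewrite -(sum_weight_particles k0 (fun _ f => (val zeta == f)%:R)) //.
rewrite exit_rate // (bigD1 zeta) //= [X in _ + X]big1 ?addr0; last first.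
  move=> eta; rewrite -val_eqE eq_sym => /negbTE ->.
  by rewrite big1 ?mulr0 // => k _; rewrite mulr0.
by congr (_ * _); apply: eq_bigr => k _; rewrite eqxx mulr1.
Qed.

(** * Stationarity as balance, and uniqueness *)

Lemma generator_balance (R : realType) (n m0 m1 : nat) (x : 'I_n -> R) (t : R)
    (f : config n m0 m1 -> R) (zeta : config n m0 m1) :
  \sum_(eta : config n m0 m1) f eta * generator x t eta zeta =
  \sum_(eta : config n m0 m1) f eta * rate x t eta zeta
    - f zeta * \sum_(xi : config n m0 m1) rate x t zeta xi.
Proof.
rewrite /generator; under eq_bigr => eta _ do rewrite mulrBr.
rewrite sumrB; congr (_ - _); rewrite (bigD1 zeta) //= eqxx [X in _ + X]big1 ?addr0 //.
by move=> eta /negbTE ->; rewrite mulr0.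
Qed.

(* The sum over all edges of these terms vanishes: expanding the square, both
   balance equations turn each of the three sums into a multiple of
   [\sum_z h z ^+ 2 * w z * (exit rate of z)]. *)
Lemma dirichlet_form_eq0 (R : realFieldType) (S : finType) (r : S -> S -> R)
    (w h : S -> R) :
  (forall a b, 0 <= r a b) -> (forall a, 0 <= w a) ->
  (forall b, \sum_a w a * r a b = w b * \sum_c r b c) ->
  (forall b, \sum_a (h a * w a) * r a b = (h b * w b) * \sum_c r b c) ->
  forall a b, w a * r a b * (h a - h b) ^+ 2 = 0.
Proof.
move=> r_ge0 w_ge0 bal_w bal_hw a b.
have term_ge0 c d : 0 <= w c * r c d * (h c - h d) ^+ 2.
  by rewrite mulr_ge0 ?sqr_ge0 // mulr_ge0.
pose E := \sum_c h c ^+ 2 * w c * \sum_d r c d.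
have sq_l : \sum_c \sum_d h c ^+ 2 * w c * r c d = E.
  by apply: eq_bigr => c _; rewrite mulr_sumr.
have sq_r : \sum_c \sum_d h d ^+ 2 * w c * r c d = E.
  rewrite exchange_big; apply: eq_bigr => d _.
  by rewrite -[RHS]mulrA -bal_w mulr_sumr; apply: eq_bigr => c _; rewrite mulrA.
have cross : \sum_c \sum_d h d * (h c * w c * r c d) = E.
  rewrite exchange_big; apply: eq_bigr => d _.
  by rewrite -mulr_sumr bal_hw; ring.
have sum0 : \sum_c \sum_d w c * r c d * (h c - h d) ^+ 2 = 0.
  transitivity (E + E - E *+ 2); last by rewrite mulr2n subrr.
  rewrite -{1}sq_l -{1}sq_r -cross -sumrMnl -!big_split -sumrB /=.
  apply: eq_bigr => c _; rewrite -sumrMnl -!big_split -sumrB /=.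
  by apply: eq_bigr => d _; ring.
have row0 : \sum_d w a * r a d * (h a - h d) ^+ 2 = 0.
  by apply: (psumr_eq0P _ sum0) => // c _; apply: sumr_ge0.
by apply: (psumr_eq0P _ row0).
Qed.

(** Only the nearest vacancy is used: its weight [t ^+ 0 = 1] is positive even when [t = 0]. *)
Lemma rate_gt0 (R : realType) (n m0 m1 : nat) (x : 'I_n -> R) (t : R)
    (A : {set 'I_n}) (k0 : 'I_n) (i : nat) (eta zeta : config n m0 m1) :
  (0 < m0)%N -> (forall k, 0 < x k) -> 0 <= t ->
  size (empty_sites A) = m0.+1 -> (i < m0.+1)%N ->
  val eta = set_config (nth k0 (empty_sites A) i |: A) ->
  val zeta = set_config (nth k0 (empty_sites A) (i.+1 %% m0.+1) |: A) ->
  0 < rate x t eta zeta.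
Proof.
move=> m0_gt0 x_gt0 t_ge0 sz hi etaE zetaE.
have geom0 := geom_gt0 m0_gt0 t_ge0.
rewrite rateE etaE; set k := nth k0 _ i.
have kA : k \notin A by rewrite -mem_empty_sites mem_nth ?sz.
have part_ge0 k1 : 0 <= (x k1)^-1 * \sum_j jump_prob m0 t (set_config (k |: A)) k1 j
    * (val zeta == move (set_config (k |: A)) k1 j)%:R.
  rewrite mulr_ge0 ?invr_ge0 ?(ltW (x_gt0 _)) // sumr_ge0 // => j _.
  by rewrite mulr_ge0 ?ler0n ?jump_prob_ge0.
rewrite (bigD1 k) /=; last by rewrite ffunE !inE eqxx.
apply: ltr_pwDl; last by apply: sumr_ge0.
rewrite mulr_gt0 ?invr_gt0 // sum_jump_prob (bigD1 (Ordinal m0_gt0)) //=.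
apply: ltr_pwDl.
  rewrite (nth_vacancies_from _ _ sz) // move_set_config // addn1 -zetaE eqxx.
  by rewrite mulr1 divr_gt0.
apply: sumr_ge0 => l _; rewrite mulr_ge0 ?ler0n // divr_ge0 ?exprn_ge0 //.
exact: ltW.
Qed.

(** Induction on a bound [d] for the size of [B :\: C]: exchanging some [a] in [B] outside [C] for
    some [b] in [C] outside [B] shrinks this difference. *)
Lemma swap_connected (T : finType) (V : Type) (m : nat) (H : {set T} -> V) :
  (forall (A : {set T}) k k', #|A| == m -> k \notin A -> k' \notin A ->
     H (k |: A) = H (k' |: A)) ->
  forall B C : {set T}, #|B| == m.+1 -> #|C| == m.+1 -> H B = H C.
Proof.
move=> swap B C; move: {2}#|B :\: C| (leqnn #|B :\: C|) => d.
elim: d B => [|d IH] B.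
  rewrite leqn0 cards_eq0 finset.setD_eq0 => sBC /eqP hB /eqP hC.
  by congr (H _); apply/eqP; rewrite eqEcard sBC hB hC leqnn.
move=> hd hB hC; case: (boolP (B \subset C)) => [sBC|/subsetPn[a aB aC]].
  by congr (H _); apply/eqP; rewrite eqEcard sBC (eqP hB) (eqP hC) leqnn.
have /subsetPn[b bC bB] : ~~ (C \subset B).
  apply/negP => sCB; have /eqP eCB : C == B.
    by rewrite eqEcard sCB (eqP hB) (eqP hC) leqnn.
  by rewrite eCB aB in aC.
have aA : a \notin B :\ a by rewrite !inE eqxx.
have bA : b \notin B :\ a by rewrite !inE (negbTE bB) andbF.
have hA : #|B :\ a| == m by have := cardsD1 a B; rewrite aB (eqP hB) add1n => -[<-].
rewrite -{1}(finset.setD1K aB) (swap _ _ _ hA aA bA).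
apply: IH => //; last by rewrite cardsU1 bA (eqP hA).
rewrite -ltnS; apply: leq_trans hd; apply: proper_card.
apply/properP; split.
  apply/fintype.subsetP => c; rewrite !inE => /andP[cC] /orP[/eqP cb|/andP[_ ->]].
    by rewrite cb bC in cC.
  by rewrite cC.
exists a; rewrite !inE ?aC ?aB // eqxx /= orbF.
by apply: contraNneq bB => <-.
Qed.

Lemma stationary_weight (R : realType) (n m0 m1 : nat) (x : 'I_n -> R) (t : R)
    (mu : {ffun config n m0 m1 -> R}) :
  (0 < m0)%N -> (0 < m1)%N -> (m0 + m1)%N = n -> (forall k, 0 < x k) ->
  0 <= t -> stationary x t mu ->
  mu = [ffun eta => weight x (val eta) / elem_sym m1 x].
Proof.
move=> m0_gt0 m1_gt0 e x_gt0 t_ge0 [_ mu1 mu_bal].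
have k0 : 'I_n by apply: (@Ordinal _ 0); lia.
have w_gt0 eta : 0 < weight x eta by apply: weight_gt0.
pose h (eta : config n m0 m1) := mu eta / weight x (val eta).
have hw eta : h eta * weight x (val eta) = mu eta.
  by rewrite /h divfK // gt_eqF.
have bal_hw zeta : \sum_eta h eta * weight x (val eta) * rate x t eta zeta =
    h zeta * weight x (val zeta) * \sum_xi rate x t zeta xi.
  rewrite hw; under eq_bigr => eta _ do rewrite hw.
  by apply/eqP; rewrite -subr_eq0 -generator_balance mu_bal.
have form0 := @dirichlet_form_eq0 _ _ (rate x t) (fun eta => weight x (val eta)) h
  (fun eta zeta => rate_ge0 eta zeta x_gt0 t_ge0) (fun eta => ltW (w_gt0 _))
  (fun zeta => weight_balance zeta m0_gt0 m1_gt0 e x_gt0 t_ge0) bal_hw.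
have {}form0 eta zeta : 0 < rate x t eta zeta -> h eta = h zeta.
  move=> r_gt0; apply/eqP; rewrite -subr_eq0 -sqrf_eq0.
  have /eqP := form0 eta zeta.
  by rewrite mulf_eq0 (gt_eqF (mulr_gt0 (w_gt0 _) r_gt0)).
(* [H] carries [h] over to sets; the default 0 occurs only for sets that are not configurations. *)
pose H (B : {set 'I_n}) := oapp h 0 (insub (set_config B)).
have HE eta B : val eta = set_config B -> H B = h eta.
  by move=> etaE; rewrite /H -etaE valK.
have H_swap (A : {set 'I_n}) k k' : #|A| == m1.-1 -> k \notin A -> k' \notin A ->
    H (k |: A) = H (k' |: A).
  move=> hA; set s := empty_sites A.
  have sz : size s = m0.+1 by rewrite size_empty_sites (eqP hA); lia.
  have cardA a : a \notin A -> #|a |: A| == m1.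
    by move=> aA; rewrite cardsU1 aA (eqP hA) add1n prednK.
  have sA i : (i < m0.+1)%N -> nth k0 s i \notin A.
    by move=> hi; rewrite -mem_empty_sites mem_nth // sz.
  have step i : (i < m0.+1)%N ->
      H (nth k0 s i |: A) = H (nth k0 s (i.+1 %% m0.+1) |: A).
    move=> hi.
    have [eta etaE] := exists_config e (cardA _ (sA _ hi)).
    have [zeta zetaE] := exists_config e (cardA _ (sA _ (ltn_pmod i.+1 (ltn0Sn m0)))).
    rewrite (HE _ _ etaE) (HE _ _ zetaE); apply: form0.
    exact: (rate_gt0 _ _ _ sz hi etaE zetaE).
  (* Nearest-vacancy jumps starting from vacancy 0 reach every vacancy of [A]. *)
  have all0 i : (i < m0.+1)%N -> H (nth k0 s i |: A) = H (nth k0 s 0 |: A).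
    elim: i => // i IH hi.
    by rewrite -IH ?(ltnW hi) // (step i (ltnW hi)) modn_small.
  rewrite -!mem_empty_sites -/s => /(nthP k0)[i hi <-] /(nthP k0)[j hj <-].
  by rewrite !all0 -?sz.
have h_const eta zeta : h eta = h zeta.
  have [B hB etaE] := config_set eta; have [C hC zetaE] := config_set zeta.
  rewrite -(HE _ _ etaE) -(HE _ _ zetaE).
  by apply: (swap_connected H_swap); rewrite prednK.
apply/ffunP => eta; rewrite ffunE -hw mulrC; congr (_ * _).
(* The constant value of [h] is fixed by the total mass of [mu]; the identity also shows that
   [elem_sym m1 x] is nonzero. *)
have he : h eta * elem_sym m1 x = 1.
  rewrite -(sum_weight _ e) mulr_sumr -mu1; apply: eq_bigr => zeta _.
  by rewrite (h_const eta zeta) hw.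
have e_neq0 : elem_sym m1 x != 0.
  by apply: contra_eq_neq he => ->; rewrite mulr0 eq_sym oner_eq0.
by rewrite -[LHS](mulfK e_neq0) he mul1r.
Qed.

(** * Evaluation of the current *)

Lemma sum_leq_ord (m a : nat) : (\sum_(i < m) (a <= i) = m - a)%N.
Proof. by elim: m => [|m IH]; rewrite ?big_ord0 // big_ord_recr /= IH; lia. Qed.

Lemma current_weight (R : realType) (n m0 m1 : nat) (x : 'I_n -> R) (t : R) :
  (0 < m1)%N -> (m0 + m1)%N = n -> (forall k, 0 < x k) ->
  current x t [ffun eta : config n m0 m1 => weight x (val eta) / elem_sym m1 x] =
    (\sum_(i < m0) i.+1%:R * t ^+ i) / (\sum_(i < m0) t ^+ i)
    * (elem_sym m1.-1 x / elem_sym m1 x).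
Proof.
move=> m1_gt0 e x_gt0.
have k0 : 'I_n by apply: (@Ordinal _ 0); lia.
rewrite /current [RHS]mulrA.
transitivity ((\sum_(eta : config n m0 m1) weight x (val eta) *
    \sum_(k | val eta k) (x k)^-1 *
      \sum_j jump_prob m0 t (val eta) k j * (j < k)%N%:R) / elem_sym m1 x).
  rewrite mulr_suml; apply: eq_bigr => eta _; rewrite ffunE mulrAC.
  congr (_ * _ / _); apply: eq_bigr => k _; congr (_ * _).
  rewrite big_mkcond; apply: eq_bigr => j _.
  by case: ltnP; rewrite ?mulr1 ?mulr0.
congr (_ / _); rewrite (sum_weight_jumps t k0 (fun k j _ => (j < k)%N%:R)) //.
rewrite elem_symE mulr_sumr; apply: eq_bigr => A /eqP hA; rewrite mulrC.
have sz : size (empty_sites A) = m0.+1 by rewrite size_empty_sites hA; lia.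
congr (_ * _); rewrite mulr_suml; apply: eq_bigr => l _ /=.
rewrite mulrAC [_.+1%:R * _]mulrC; congr (_ * _ / _).
rewrite -natr_sum; congr _%:R.
have hl := ltn_ord l.
(* A shift by [l.+1] passes the last vacancy exactly when [m0 - l <= i], which leaves [l.+1]
   starting positions. *)
transitivity (\sum_(i < m0.+1) (m0 - l <= i))%N; last by rewrite sum_leq_ord; lia.
apply: eq_bigr => i _; congr nat_of_bool.
rewrite empty_sites_lt ?sz ?ltn_pmod //.
have hi := ltn_ord i.
case: (leqP (m0 - l) i) => hli; last first.
  rewrite modn_small; last by lia.
  by apply/negbTE; rewrite -leqNgt; lia.
(* As [l < m0], the shift is less than a full turn, so the wrapped index is strictly below [i]. *)
have -> : (i + l.+1 = (i - (m0 - l)) + m0.+1)%N by lia.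
by rewrite modnDr modn_small; lia.
Qed.

(** The sum is a polynomial function, so the formal derivative applies; the constant term drops out
    and shifts the index. *)
Lemma derive1_geom (R : realType) (m : nat) (t : R) :
  derive1 (fun s : R => \sum_(i < m.+1) s ^+ i) t = \sum_(i < m) i.+1%:R * t ^+ i.
Proof.
have -> : (fun s : R => \sum_(i < m.+1) s ^+ i) = horner (\sum_(i < m.+1) 'X^i).
  by apply/funext => s; rewrite horner_sum; apply: eq_bigr => i _; rewrite hornerXn.
rewrite -derivE raddf_sum /= horner_sum big_ord_recl derivXn mulr0n horner0 add0r.
by apply: eq_bigr => i _; rewrite derivXn hornerMn hornerXn mulr_natl.
Qed.

Theorem theorem1p5 (R : realType) (n m0 m1 : nat) (x : 'I_n -> R) (t : R)
    (m0_gt0 : (0 < m0)%N) (m1_gt0 : (0 < m1)%N) (m01 : (m0 + m1)%N = n)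
    (x_gt0 : forall k, 0 < x k) (t_ge0 : 0 <= t) (t_lt1 : t < 1) :
  (exists! pi : {ffun config n m0 m1 -> R}, stationary x t pi) /\
  (forall pi : {ffun config n m0 m1 -> R}, stationary x t pi ->
     current x t pi =
       (\sum_(i < m0) i.+1%:R * t ^+ i) / (\sum_(i < m0) t ^+ i)
       * (elem_sym m1.-1 x / elem_sym m1 x) /\
     current x t pi =
       derive1 (fun s : R => \sum_(i < m0.+1) s ^+ i) t / (\sum_(i < m0) t ^+ i)
       * (elem_sym m1.-1 x / elem_sym m1 x)).
Proof.
split; last first.
  move=> pi /(stationary_weight m0_gt0 m1_gt0 m01 x_gt0 t_ge0) ->.
  by rewrite derive1_geom current_weight.
exists [ffun eta => weight x (val eta) / elem_sym m1 x]; split; last first.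
  by move=> pi /(stationary_weight m0_gt0 m1_gt0 m01 x_gt0 t_ge0) ->.
(* A configuration exists because ['C(n, m1)] is positive; this makes the normalising constant
   positive. *)
have [B hB] : exists B : {set 'I_n}, #|B| == m1.
  have : (0 < #|[set B : {set 'I_n} | #|B| == m1]%SET|)%N.
    by rewrite card_draws card_ord bin_gt0 -m01 leq_addl.
  by case/card_gt0P => B; rewrite inE => hB; exists B.
have [eta0 _] := exists_config m01 hB.
have e_gt0 : 0 < elem_sym m1 x.
  rewrite -(sum_weight x m01) (bigD1 eta0) //= ltr_pwDl ?weight_gt0 //.
  by apply: sumr_ge0 => eta _; rewrite ltW ?weight_gt0.
split=> [eta||zeta].
- by rewrite ffunE divr_ge0 ?ltW ?weight_gt0.
- under eq_bigr => eta _ do rewrite ffunE.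
  by rewrite -mulr_suml sum_weight // divff // gt_eqF.
rewrite generator_balance ffunE; under eq_bigr => eta _ do rewrite ffunE mulrAC.
by rewrite -mulr_suml weight_balance // mulrAC subrr.
Qed.
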